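(* Let $f_1,\dots,f_m$ be analytic functions of $m$ real variables and let $\boldsymbol{Q}_i(\boldsymbol{\Omega}_1)\vec X_i$, $i=1,\dots,m$, be $\boldsymbol{\Omega}_1$-eligible decay functions ($\boldsymbol{Q}_i(\boldsymbol{\Omega}_1)$ an $N\times N$ matrix). For an ordering $S_r$, consider the uniform mean field extended system for $\vec X_1,\dots,\vec X_m\in\mathbb{R}^N$ built with the standard non-commutative map, $$\frac{d\vec X_s}{dt}=\boldsymbol{\Omega}_1\sum_{k\ge0}\ \sum_{i_1+\dots+i_m=k}a_{s,k;i_1,\dots,i_m}\{(\boldsymbol{\Omega}_1\boldsymbol{X}_1)^{i_1}\cdots(\boldsymbol{\Omega}_1\boldsymbol{X}_m)^{i_m}\}_{S_r}\vec 1+\boldsymbol{Q}_s(\boldsymbol{\Omega}_1)\vec X_s,\qquad s=1,\dots,m.$$ This system is ordering independent: for any two orderings $S_r$ and $S_{r'}$, the corresponding systems of differential equations coincide.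
   Context: $\vec 1\in\mathbb{R}^N$ is the all-ones vector, $\boldsymbol{I}$ the identity, $\boldsymbol{\Omega}_1$ (uniform mean-field projector) the $N\times N$ matrix with all entries $1/N$, and $\boldsymbol{X}_s=\mathrm{diag}(X_{s,1},\dots,X_{s,N})$ for $\vec X_s=(X_{s,1},\dots,X_{s,N})$. A matrix to the power zero is the identity. The coefficients are those of the Taylor series $f_s(x_1,\dots,x_m)=\sum_{k\ge0}\sum_{i_1+\dots+i_m=k}a_{s,k;i_1,\dots,i_m}x_1^{i_1}\cdots x_m^{i_m}$, assumed valid on all of $\mathbb{R}^m$. An ordering $S$ is a choice of real coefficients $o_\sigma$, $\sigma$ ranging over the permutations $\mathcal{S}(m)$ of $\{1,\dots,m\}$, with $\sum_{\sigma}o_\sigma=1$; then $$\{(\boldsymbol{\Omega}_1\boldsymbol{X}_1)^{i_1}\cdots(\boldsymbol{\Omega}_1\boldsymbol{X}_m)^{i_m}\}_S=\sum_{\sigma\in\mathcal{S}(m)}o_\sigma(\boldsymbol{\Omega}_1\boldsymbol{X}_{\sigma(1)})^{i_{\sigma(1)}}\cdots(\boldsymbol{\Omega}_1\boldsymbol{X}_{\sigma(m)})^{i_{\sigma(m)}}.$$ A decay function $\vec G_i(\boldsymbol{\Omega}_1;\vec X_i)$ is $\boldsymbol{\Omega}_1$-eligible if, along solutions of the extended system, $\lim_{t\to+\infty}\boldsymbol{\Omega}_1\vec G_i(\boldsymbol{\Omega}_1;\vec X_i(t))=\vec 0$ and if $\vec X_{ci}=(\boldsymbol{I}-\boldsymbol{\Omega}_1)\vec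 X_i$, which satisfies $\frac{d\vec X_{ci}}{dt}=(\boldsymbol{I}-\boldsymbol{\Omega}_1)\vec G_i(\boldsymbol{\Omega}_1;\vec X_i)$, tends to $\vec 0$ as $t\to\infty$. *)

(* Defs.v *)
From HB Require Import structures.
From mathcomp Require Import all_boot all_order all_fingroup all_algebra.
From mathcomp Require Import all_classical all_reals all_analysis.

Set Implicit Arguments.
Unset Strict Implicit.
Unset Printing Implicit Defensive.

Import Order.TTheory GRing.Theory Num.Theory.
Import numFieldNormedType.Exports.
Local Open Scope classical_set_scope.
Local Open Scope ring_scope.

(* Sum over the multi-indices i_1 + ... + i_m = k; each i_j is then at most k,
   so the sum ranges over a finite type. *)
Definition degree_sum (V : nmodType) (m k : nat) (F : ('I_m -> nat) -> V) : V :=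
  \sum_(i : {ffun 'I_m -> 'I_k.+1} | (\sum_j (i j : nat) == k)%N)
     F (fun j => i j : nat).

Section PowerSeries.
Variables (R : realType) (m : nat).
Implicit Types (f : 'rV[R]_m -> R) (i : 'I_m -> nat) (x h : 'rV[R]_m).

Definition monomial x i : R := \prod_j x ord0 j ^+ i j.

(* Convergence of a multivariate power series near a point is absolute. *)
Definition real_analytic f : Prop :=
  forall x, exists c : ('I_m -> nat) -> R, exists2 r : R, 0 < r &
    forall h, (forall j, `|h ord0 j| < r) ->
      cvgn (series (fun k => degree_sum k (fun i => `|c i * monomial h i|))) /\
      series (fun k => degree_sum k (fun i => c i * monomial h i)) @ \oo
        --> f (x + h).

Definition partial_derivative (j : 'I_m) f : 'rV[R]_m -> R :=
  fun x => 'D_(delta_mx ord0 j) f x.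

Definition mixed_partial i f : 'rV[R]_m -> R :=
  foldr (fun j g => iter (i j) (partial_derivative j) g) f (enum 'I_m).

Definition taylor_coef f i : R := mixed_partial i f 0 / (\prod_j (i j)`!)%:R.

Definition taylor_valid f : Prop :=
  forall x, series (fun k =>
    degree_sum k (fun i => taylor_coef f i * monomial x i)) @ \oo --> f x.

End PowerSeries.

Section MeanField.
Variables (R : realType) (m N : nat).

Definition Omega1 : 'M[R]_N := const_mx (N%:R)^-1.

Definition ordering (S : 'S_m -> R) : Prop := \sum_(sigma : 'S_m) S sigma = 1.

Definition ordered_product (S : 'S_m -> R) (x : 'I_m -> 'cV[R]_N)
    (i : 'I_m -> nat) : 'M[R]_N :=
  \sum_(sigma : 'S_m) S sigma *:
    \prod_(j < m) (Omega1 *m diag_mx (x (sigma j))^T) ^+ i (sigma j).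

(* The series is taken in R^N, after application to the all-ones vector. *)
Definition mean_field_series (S : 'S_m -> R) (f : 'rV[R]_m -> R)
    (x : 'I_m -> 'cV[R]_N) : nat -> 'cV[R]_N :=
  series (fun k => degree_sum k (fun i =>
    taylor_coef f i *: (ordered_product S x i *m const_mx 1))).

Variables (f : 'I_m -> 'rV[R]_m -> R)
          (G : 'I_m -> 'M[R]_N -> 'cV[R]_N -> 'cV[R]_N).

Definition extended_field (S : 'S_m -> R) (x : 'I_m -> 'cV[R]_N) (s : 'I_m)
    : 'cV[R]_N :=
  Omega1 *m limn (mean_field_series S (f s) x) + G s Omega1 (x s).

Definition extended_solution (S : 'S_m -> R) (X : 'I_m -> R -> 'cV[R]_N)
    : Prop :=
  forall s,
    X s t @[t --> 0^'+] --> X s 0 /\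
    forall t : R, 0 < t ->
      is_derive t 1 (X s) (extended_field S (fun j => X j t) s).

(* Along a solution, (1 - Omega1) X_i has derivative (1 - Omega1) G_i, because
   (1 - Omega1) Omega1 = 0; this is therefore not a separate requirement. *)
Definition eligible (S : 'S_m -> R) (i : 'I_m) : Prop :=
  forall X, extended_solution S X ->
    Omega1 *m G i Omega1 (X i t) @[t --> +oo] --> (0 : 'cV[R]_N) /\
    (1%:M - Omega1) *m X i t @[t --> +oo] --> (0 : 'cV[R]_N).

End MeanField.

(* Main.v *)
(* The all-ones vector is a common eigenvector of the matrices
   [Omega1 *m diag_mx x^T], with eigenvalue the mean of [x].  Any ordered product
   applied to it thus yields the same monomial in the means, times the sum 1 of
   the ordering coefficients: the mean-field series is the Taylor series of [f]
   at the means, times the all-ones vector. *)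

Require Import Defs.
From HB Require Import structures.
From mathcomp Require Import all_boot all_order all_fingroup all_algebra.
From mathcomp Require Import all_classical all_reals all_analysis.

Set Implicit Arguments.
Unset Strict Implicit.
Unset Printing Implicit Defensive.

Import Order.TTheory GRing.Theory Num.Theory.
Import numFieldNormedType.Exports.
Local Open Scope classical_set_scope.
Local Open Scope ring_scope.

Section CommonEigenvector.
Variables (R : comNzRingType) (N : nat) (v : 'cV[R]_N).

Lemma expmx_eigenvector (A : 'M[R]_N) (a : R) (k : nat) :
  A *m v = a *: v -> A ^+ k *m v = a ^+ k *: v.
Proof.
move=> Av; elim: k => [|k IHk]; first by rewrite !expr0 mul1mx scale1r.
by rewrite !exprS -mulmxA IHk -scalemxAr Av scalerA mulrC.
Qed.

(** Each factor acting on [v] releases a scalar, which moves past the remaining matrices; the [A j]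
    themselves need not commute. *)
Lemma prodmx_eigenvector (I : Type) (r : seq I) (A : I -> 'M[R]_N)
    (a : I -> R) :
  (forall j, A j *m v = a j *: v) ->
  (\prod_(j <- r) A j) *m v = (\prod_(j <- r) a j) *: v.
Proof.
move=> Av; elim/big_rec2: _ => [|j b B _ IH]; first by rewrite mul1mx scale1r.
by rewrite -mulmxA IH -scalemxAr Av scalerA mulrC.
Qed.

End CommonEigenvector.

Section MeanField.
Variables (R : realType) (m N : nat).
Implicit Types (x : 'I_m -> 'cV[R]_N) (S : 'S_m -> R).

(** The weight stays inside the sum to match the row sums of [Omega1 *m diag_mx y^T] term by
    term. *)
Definition mean (y : 'cV[R]_N) : R := \sum_l (N%:R)^-1 * y l ord0.

Definition means x : 'rV[R]_m := \row_j mean (x j).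

Lemma Omega1_diag_ones (y : 'cV[R]_N) :
  (Omega1 R N *m diag_mx y^T) *m const_mx 1 = mean y *: const_mx 1 :> 'cV[R]_N.
Proof.
apply/matrixP => i j; rewrite !mxE mulr1; apply: eq_bigr => l _.
by rewrite mul_mx_diag !mxE mulr1.
Qed.

Lemma ordered_product_ones S x (i : 'I_m -> nat) :
  ordering S ->
  ordered_product S x i *m const_mx 1 =
  monomial (means x) i *: const_mx 1 :> 'cV[R]_N.
Proof.
(* Expanding 1 on the right as the sum of the [S sigma] allows a comparison permutation by
   permutation. *)
move=> S1; rewrite mulmx_suml -[RHS]scale1r -[X in _ = X *: _]S1 scaler_suml.
apply: eq_bigr => sigma _; rewrite -scalemxAl; congr (_ *: _).
rewrite (prodmx_eigenvector _ (a := fun j => mean (x (sigma j)) ^+ i (sigma j)));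
  last by move=> j; exact/expmx_eigenvector/Omega1_diag_ones.
(* The eigenvalues commute, so reindexing the monomial along [sigma] absorbs the permutation. *)
congr (_ *: _); rewrite /monomial [RHS](reindex_inj (@perm_inj _ sigma)) /=.
by apply: eq_bigr => j _; rewrite mxE.
Qed.

(** The identity holds for each partial sum, before any limit, and [S] is absent from its right-hand
    side. *)
Lemma mean_field_seriesE S (f : 'rV[R]_m -> R) x :
  ordering S ->
  mean_field_series S f x =
  (fun n => series (fun k => degree_sum k (fun i =>
     taylor_coef f i * monomial (means x) i)) n *: const_mx 1).
Proof.
move=> S1; apply/funext => n; rewrite /mean_field_series /series /=.
rewrite scaler_suml; apply: eq_bigr => k _.
rewrite /degree_sum scaler_suml; apply: eq_bigr => i _.
by rewrite ordered_product_ones// scalerA.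
Qed.

Lemma cvg_mean_field_series S (f : 'rV[R]_m -> R) x :
  ordering S -> taylor_valid f ->
  mean_field_series S f x @ \oo --> f (means x) *: (const_mx 1 : 'cV[R]_N).
Proof.
by move=> S1 fT; rewrite mean_field_seriesE//; apply: cvgZr_tmp; exact: fT.
Qed.

End MeanField.

Theorem corollary3p13 (R : realType) (m N : nat) (m_gt0 : (0 < m)%N)
    (N_gt0 : (0 < N)%N)
    (f : 'I_m -> 'rV[R]_m -> R)
    (f_analytic : forall s, real_analytic (f s))
    (f_taylor : forall s, taylor_valid (f s))
    (Q : 'I_m -> 'M[R]_N -> 'M[R]_N)
    (S S' : 'S_m -> R) (S_ordering : ordering S) (S'_ordering : ordering S')
    (Q_eligible : forall i, eligible f (fun s Om x => Q s Om *m x) S i)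
    (Q_eligible' : forall i, eligible f (fun s Om x => Q s Om *m x) S' i) :
  forall (x : 'I_m -> 'cV[R]_N) (s : 'I_m),
    [/\ cvgn (mean_field_series S (f s) x),
        cvgn (mean_field_series S' (f s) x) &
        extended_field f (fun s Om x => Q s Om *m x) S x s =
        extended_field f (fun s Om x => Q s Om *m x) S' x s].
Proof.
move=> x s.
have cS := cvg_mean_field_series (x := x) S_ordering (f_taylor s).
have cS' := cvg_mean_field_series (x := x) S'_ordering (f_taylor s).
split; [exact: cvgP cS | exact: cvgP cS' |].
(* Both [limn] are now taken of one and the same sequence; [cS] and [cS'] ensure that they are true
   limits, not default values. *)
by rewrite /extended_field !mean_field_seriesE.
Qed.
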